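(* Let $p \in \mathbb{N}$, let $\mathbf{X} = (X_1,\dots,X_p)$ be an $\mathbb{R}^p$-valued random vector and let $Y \in L^2$ be a non-degenerate real-valued random variable on a common probability space. Let $(Y,Y')$ be the Markov product of $(\mathbf{X},Y)$, i.e. $Y'$ is a conditionally independent copy of $Y$ given $\mathbf{X}$. Then the following statements are equivalent: (a) $\xi(Y|\mathbf{X}) = R^2(Y|\mathbf{X}) = 1$. (b) $Y$ perfectly depends on $\mathbf{X}$, i.e. there exists some measurable function $f$ such that $Y = f(\mathbf{X})$ almost surely. (c) $Y$ and $Y'$ are comonotone. (d) $Y = Y'$ almost surely.
   Context: Markov product: $Y'$ is a random variable such that, for $\mathbb{P}^{\mathbf{X}}$-almost all $\mathbf{x} \in \mathbb{R}^p$, the conditional distribution of $Y'$ given $\mathbf{X}=\mathbf{x}$ equals the conditional distribution of $Y$ given $\mathbf{X}=\mathbf{x}$, and $Y$ and $Y'$ are conditionally independent given $\mathbf{X}$. The pair $(Y,Y')$ is called the Markov product of $(\mathbf{X},Y)$. Coefficients: for $Y$ non-degenerate (i.e. not almost surely constant), $$\xi(Y|\mathbf{X}) := \frac{\int_{\mathbb{R}} \operatorname{Var}(\mathbb{P}(Y \geq y \mid \mathbf{X})) \, d\mathbb{P}^Y(y)}{\int_{\mathbb{R}} \operatorname{Var}(\mathbf{1}_{\{Y \geq y\}}) \, d\mathbb{P}^Y(y)},$$ and for $Y \in L^2$ non-degenerate, $$R^2(Y|\mathbf{X}) := \frac{\operatorname{Var}(\mathbb{E}(Y|\mathbf{X}))}{\operatorname{Var}(Y)}.$$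 Here $\mathbb{P}^Z$ denotes the distribution of $Z$. Comonotone: $Y$ and $Y'$ are comonotone if $\mathbb{P}(Y \leq y, Y' \leq y') = \min\{F_Y(y), F_{Y'}(y')\}$ for all $(y,y') \in \mathbb{R}^2$, where $F_Z$ denotes the distribution function of a random variable $Z$. *)

(* Defs.v *)
From HB Require Import structures.
From mathcomp Require Import all_boot all_order all_algebra.
From mathcomp Require Import all_classical all_reals all_analysis.

Set Implicit Arguments.
Unset Strict Implicit.
Unset Printing Implicit Defensive.

Import Order.TTheory GRing.Theory Num.Theory.
Import numFieldNormedType.Exports.

Local Open Scope classical_set_scope.
Local Open Scope ring_scope.

(* [W] is a version of E(Z | X): integrable, sigma(X)-measurable, with the same
   integral as [Z] over every event of sigma(X). *)
Definition is_cond_exp d d' (T : measurableType d) (U : measurableType d')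
    (R : realType) (P : probability T R) (X : {RV P >-> U}) (Z W : T -> R) :
    Prop :=
  [/\ P.-integrable [set: T] (EFin \o W),
      measurable_fun [set: g_sigma_algebra_preimageType X] W &
      forall B : set T, g_sigma_algebra_preimage X B ->
        (\int[P]_(w in B) (W w)%:E = \int[P]_(w in B) (Z w)%:E)%E].

(* A chosen version of E(Z | X). Versions exist whenever [Z] is integrable and
   agree almost surely; without a version the value is 0. *)
Definition cond_exp d d' (T : measurableType d) (U : measurableType d')
    (R : realType) (P : probability T R) (X : {RV P >-> U}) (Z : T -> R) :
    T -> R :=
  xget (cst 0) [set W | is_cond_exp X Z W].

Definition cond_prob d d' (T : measurableType d) (U : measurableType d')
    (R : realType) (P : probability T R) (X : {RV P >-> U}) (A : set T) :
    T -> R :=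
  cond_exp X \1_A.

(* [K] is a regular version of the conditional distribution of [Y] given [X]. *)
Definition is_cond_distribution d d' d'' (T : measurableType d)
    (U : measurableType d') (V : measurableType d'') (R : realType)
    (P : probability T R) (X : {RV P >-> U}) (Y : {RV P >-> V})
    (K : R.-pker U ~> V) : Prop :=
  forall (A : set U) (B : set V), measurable A -> measurable B ->
    P (X @^-1` A `&` Y @^-1` B) = (\int[distribution P X]_(x in A) K x B)%E.

(* Regular versions always exist for real-valued [Y], [Y'] and are unique up to
   P^X-null sets, so the existential merely names them. *)
Definition same_cond_distribution d d' (T : measurableType d)
    (U : measurableType d') (R : realType) (P : probability T R)
    (X : {RV P >-> U}) (Y Y' : {RV P >-> R}) : Prop :=
  exists K K' : R.-pker U ~> R,
    [/\ is_cond_distribution X Y K, is_cond_distribution X Y' K' &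
        {ae distribution P X, forall x : U,
          forall B : set R, measurable B -> K' x B = K x B}].

Definition cond_independent d d' (T : measurableType d)
    (U : measurableType d') (R : realType) (P : probability T R)
    (X : {RV P >-> U}) (Y Y' : {RV P >-> R}) : Prop :=
  forall A B : set R, measurable A -> measurable B ->
    {ae P, forall w : T,
      cond_prob X (Y @^-1` A `&` Y' @^-1` B) w =
      cond_prob X (Y @^-1` A) w * cond_prob X (Y' @^-1` B) w}.

Definition markov_product d d' (T : measurableType d)
    (U : measurableType d') (R : realType) (P : probability T R)
    (X : {RV P >-> U}) (Y Y' : {RV P >-> R}) : Prop :=
  same_cond_distribution X Y Y' /\ cond_independent X Y Y'.

Definition degenerate d (T : measurableType d) (R : realType)
    (P : probability T R) (Y : {RV P >-> R}) : Prop :=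
  exists c : R, {ae P, forall w : T, Y w = c}.

(* For non-degenerate [Y] all the (extended-real) quantities below are finite
   and the denominators are positive, so [fine] and [/] lose nothing. *)
Definition xi_coef d d' (T : measurableType d) (U : measurableType d')
    (R : realType) (P : probability T R) (Y : {RV P >-> R})
    (X : {RV P >-> U}) : R :=
  fine (\int[distribution P Y]_y 'V_P[cond_prob X [set w | (y <= Y w)%R]])%E /
  fine (\int[distribution P Y]_y
          'V_P[(\1_[set w | (y <= Y w)%R] : T -> R)])%E.

(* Finiteness here requires in addition that [Y] is square-integrable. *)
Definition R2_coef d d' (T : measurableType d) (U : measurableType d')
    (R : realType) (P : probability T R) (Y : {RV P >-> R})
    (X : {RV P >-> U}) : R :=
  fine ('V_P[cond_exp X Y])%E / fine ('V_P[Y])%E.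

Definition perfectly_depends d d' (T : measurableType d)
    (U : measurableType d') (R : realType) (P : probability T R)
    (Y : {RV P >-> R}) (X : {RV P >-> U}) : Prop :=
  exists2 f : U -> R, measurable_fun [set: U] f &
    {ae P, forall w : T, Y w = f (X w)}.

Definition comonotone d (T : measurableType d) (R : realType)
    (P : probability T R) (Y Y' : {RV P >-> R}) : Prop :=
  forall y y' : R,
    P [set w | Y w <= y /\ Y' w <= y'] = Order.min (cdf Y y) (cdf Y' y').

(* Main.v *)
Require Import Defs.
From mathcomp Require Import all_boot all_order all_algebra.
From mathcomp Require Import finmap.
From mathcomp Require Import all_classical all_reals all_analysis.
From mathcomp Require Import measurable_realfun.

Set Implicit Arguments.
Unset Strict Implicit.
Unset Printing Implicit Defensive.

Import Order.TTheory GRing.Theory Num.Theory.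
Import numFieldNormedType.Exports.

Local Open Scope classical_set_scope.
Local Open Scope ring_scope.

(** The four conditions all say that Y is, up to null sets, a function of X.

    The common mechanism is that the real line is order-separated by the
    rationals. A random variable Z is almost surely a measurable function of X
    as soon as each event {Z < q}, q rational, is almost surely of the form
    {X in C q}: the function is x |-> inf {q | x in C q}
    ([fun_of_rat_events]). And two random variables are almost surely equal as
    soon as no rational separates them with positive probability
    ([ae_le_of_rat_gaps]).

    - Coefficients equal to 1 give dependence. A version W of E(Y|X) is
      orthogonal to the residual Y - W, so Var Y = Var W + Var (Y - W). If
      R^2 = 1 the residual has variance 0 and Y = W almost surely, and W is
      sigma(X)-measurable ([full_variance_perfectly_depends]).
    - Dependence gives comonotonicity. (X, Y') has the law of (X, Y), so
      Y = f(X) forces Y' = f(X), hence Y = Y' almost surely, and a variable is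
      comonotone with itself.
    - Comonotonicity gives equality. Y and Y' have the same distribution
      function F, so P(Y <= q, Y' <= q) = F(q) = P(Y <= q) = P(Y' <= q), and no
      rational q separates Y from Y' ([comonotone_ae_eq]).
    - Equality gives dependence and then coefficients equal to 1. If Y = Y',
      conditional independence reads P(A|X) = P(A|X)^2 for every event
      A = {Y in B}. A conditional probability with values in {0, 1} is the
      indicator of an event of sigma(X), which then agrees with A
      ([cond_prob_idempotent]); the rational criterion gives Y = f(X). Now
      E(Y|X) = Y and P(Y >= y|X) = 1_{Y >= y} almost surely, so both
      coefficients are quotients of equal numbers. What remains is that the
      denominators do not vanish, which is where non-degeneracy enters: for xi
      it is [indic_variance_integral_neq0]. *)

(** * Almost sure statements *)

Lemma ae_all_count d (T : measurableType d) (R : realType)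
    (mu : {measure set T -> \bar R}) (I : countType) (Q : I -> T -> Prop) :
  (forall i, {ae mu, forall w, Q i w}) -> {ae mu, forall w, forall i, Q i w}.
Proof.
move=> aeQ.
pose Q' n w := if choice.unpickle n is Some i then Q i w else True.
have : {ae mu, forall w n, Q' n w}.
  apply: ae_foralln => n; rewrite /Q'.
  by case: choice.unpickle => [i//|]; exact: filterE.
apply: filterS => w Qw i; have := Qw (choice.pickle i).
by rewrite /Q' choice.pickleK.
Qed.

Lemma prob0_ae d (T : measurableType d) (R : realType)
    (P : probability T R) (A : set T) :
  measurable A -> P A = 0%E -> {ae P, forall w, ~ A w}.
Proof.
by move=> mA PA; exists A; split => // w /= /contrapT.
Qed.

Lemma ae_prob0 d (T : measurableType d) (R : realType)
    (P : probability T R) (A : set T) :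
  measurable A -> {ae P, forall w, ~ A w} -> P A = 0%E.
Proof.
move=> mA [N [mN PN sN]]; apply/eqP; rewrite -measure_le0 -PN.
by apply: le_measure; rewrite ?inE// => w Aw; apply: sN => /=; exact.
Qed.

Lemma prob_ae_eq d (T : measurableType d) (R : realType)
    (P : probability T R) (A B : set T) :
  measurable A -> measurable B -> {ae P, forall w, A w <-> B w} -> P A = P B.
Proof.
move=> mA mB AB.
have PE C : measurable C -> P C = (\int[P]_w (\1_C w)%:E)%E.
  by move=> mC; rewrite integral_indic// setIT.
rewrite !PE//.
apply: ae_eq_integral => //; [exact/measurable_EFinP..|].
apply: filterS AB => w AB _; congr EFin; rewrite !indicE; congr (_%:R).
by congr nat_of_bool; apply/idP/idP; rewrite !inE => /AB.
Qed.

(** * Versions of a conditional expectation *)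

Section conditional_expectation.
Context d d' (T : measurableType d) (U : measurableType d') (R : realType).
Variables (P : probability T R) (X : {RV P >-> U}).

Lemma sigmaXP (B : set T) : g_sigma_algebra_preimage X B <->
  exists2 C, measurable C & B = X @^-1` C.
Proof.
by split=> -[C mC]; [move=> <-|move=> ->]; exists C => //; rewrite setTI.
Qed.

Lemma sigmaX_measurable (B : set T) :
  g_sigma_algebra_preimage X B -> measurable B.
Proof. by move/sigmaXP => [C mC ->]; exact: measurable_funPTI. Qed.

Lemma sigmaX_fun (f : U -> R) : measurable_fun [set: U] f ->
  measurable_fun [set: g_sigma_algebra_preimageType X] (f \o X).
Proof.
move=> mf _ B mB; rewrite setTI; apply/sigmaXP.
by exists (f @^-1` B) => //; rewrite -[_ @^-1` _]setTI; exact: mf.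
Qed.

Lemma sigmaX_fun_measurable (W : T -> R) :
  measurable_fun [set: g_sigma_algebra_preimageType X] W ->
  measurable_fun [set: T] W.
Proof. by move=> mW _ B mB; apply: sigmaX_measurable; exact: mW. Qed.

Lemma is_cond_exp_measurable Z W :
  is_cond_exp X Z W -> measurable_fun [set: T] W.
Proof. by case=> /measurable_int/measurable_EFinP. Qed.

(** On the event {W < W'} of sigma(X) the nonnegative variable W' - W integrates
    to 0, so that event is null. *)
Lemma is_cond_exp_ae_le Z W W' : is_cond_exp X Z W -> is_cond_exp X Z W' ->
  {ae P, forall w, W' w <= W w}.
Proof.
move=> [iW mW WZ] [iW' mW' W'Z].
pose B : set T := [set w | W w < W' w].
have sB : g_sigma_algebra_preimage X B.
  have -> : B = setT `&` (fun w => W w < W' w) @^-1` [set true].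
    by rewrite setTI.
  exact: (@measurable_fun_ltr _ (g_sigma_algebra_preimageType X)).
have mB := sigmaX_measurable sB.
have iWB : P.-integrable B (EFin \o W) by apply: integrableS iW.
have iW'B : P.-integrable B (EFin \o W') by apply: integrableS iW'.
have D0 : (\int[P]_(w in B) (W' w - W w)%:E = 0)%E.
  rewrite integralB_EFin//= WZ// W'Z// subee//.
  by rewrite -WZ//; exact: integrable_fin_num.
have := @ae_eq_integral_abs _ _ _ P B mB (fun w => (W' w - W w)%:E).
case=> [|+ _].
  have := measurable_int _ (integrableB mB iW'B iWB).
  by apply: eq_measurable_fun.
case.
  rewrite -[RHS]D0; apply: eq_integral => w; rewrite inE /B/= => WW.
  by rewrite ger0_norm// subr_ge0 ltW.
move=> N [mN PN sN]; exists N; split => // w /=.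
move=> /negP; rewrite -ltNge => Bw; apply: sN => /= /(_ Bw) [].
by move/eqP; rewrite subr_eq0 => /eqP E; move: Bw; rewrite E ltxx.
Qed.

Lemma is_cond_exp_ae_unique Z W W' : is_cond_exp X Z W -> is_cond_exp X Z W' ->
  {ae P, forall w, W w = W' w}.
Proof.
move=> WZ W'Z; have := is_cond_exp_ae_le WZ W'Z.
apply: filterS2 (is_cond_exp_ae_le W'Z WZ) => w *.
by apply/eqP; rewrite eq_le; apply/andP.
Qed.

Lemma cond_expP Z W : is_cond_exp X Z W -> is_cond_exp X Z (cond_exp X Z).
Proof. by move=> ZW; apply: (xgetPex (cst 0)); exists W. Qed.

Lemma cond_exp_ae Z W : is_cond_exp X Z W ->
  {ae P, forall w, cond_exp X Z w = W w}.
Proof. by move=> ZW; apply: is_cond_exp_ae_unique (cond_expP ZW) ZW. Qed.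

Lemma is_cond_exp_ae_eq Z Z' W : measurable_fun [set: T] Z ->
  measurable_fun [set: T] Z' -> {ae P, forall w, Z w = Z' w} ->
  is_cond_exp X Z W -> is_cond_exp X Z' W.
Proof.
move=> mZ mZ' ZZ' [iW mW WZ]; split=> // B sB; rewrite WZ//.
have mB := sigmaX_measurable sB.
apply: ae_eq_integral => //.
- by apply/measurable_EFinP; apply: measurable_funTS.
- by apply/measurable_EFinP; apply: measurable_funTS.
- by apply: filterS ZZ' => w -> _.
Qed.

Lemma is_cond_exp_fun Z (f : U -> R) : measurable_fun [set: U] f ->
  P.-integrable setT (EFin \o Z) -> {ae P, forall w, Z w = f (X w)} ->
  is_cond_exp X Z (f \o X).
Proof.
move=> mf iZ Zf.
have mZ : measurable_fun setT Z by exact/measurable_EFinP/(measurable_int P).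
have mfX : measurable_fun setT (f \o X).
  exact: sigmaX_fun_measurable (sigmaX_fun mf).
apply: (@is_cond_exp_ae_eq (f \o X)) => //; first by apply: filterS Zf.
split=> //; last exact: (sigmaX_fun mf).
apply/integrableP; split; first exact/measurable_EFinP.
move/integrableP : iZ => [_]; congr (_ < _)%E.
apply: ae_eq_integral => //; first exact/measurableT_comp/measurable_EFinP.
  exact/measurableT_comp/measurable_EFinP.
by apply: filterS Zf => w /= -> _.
Qed.

(** The chosen version inherits almost sure statements from any explicit one;
    this evaluates conditional expectations of functions of X. *)
Lemma cond_exp_fun Z (f : U -> R) : measurable_fun [set: U] f ->
  P.-integrable setT (EFin \o Z) -> {ae P, forall w, Z w = f (X w)} ->
  measurable_fun [set: T] (cond_exp X Z) /\
  {ae P, forall w, cond_exp X Z w = Z w}.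
Proof.
move=> mf iZ Zf; have Zc := is_cond_exp_fun mf iZ Zf; split.
  exact: is_cond_exp_measurable (cond_expP Zc).
by apply: filterS2 Zf (cond_exp_ae Zc) => w -> ->.
Qed.

(** This supplies the existence of conditional probabilities of events
    {Y in B}: without a version the chosen conditional expectation is
    identically 0 and carries no information. *)
Lemma is_cond_exp_kernel (Y : {RV P >-> R}) (K : R.-pker U ~> R) (B : set R) :
  is_cond_distribution X Y K -> measurable B ->
  is_cond_exp X \1_(Y @^-1` B) (fun w => fine (K (X w) B)).
Proof.
move=> XYK mB.
have fK x : K x B \is a fin_num.
  rewrite ge0_fin_numE//; apply: le_lt_trans (ltry 1).
  by rewrite -(@prob_kernel _ _ _ _ _ K x); apply: le_measure; rewrite ?inE.
have mK : measurable_fun [set: U] (fun x => fine (K x B)).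
  exact: (measurableT_comp (fine_measurable measurableT)
    (measurable_kernel K _ mB)).
have mKX : measurable_fun [set: T] (fun w => fine (K (X w) B)).
  exact: sigmaX_fun_measurable (sigmaX_fun mK).
have mYB : measurable (Y @^-1` B) by exact: measurable_funPTI.
split; [|exact: (sigmaX_fun mK)|].
  apply: (@le_integrable _ _ _ P setT _ _ (EFin \o cst 1%R)) => //.
  - exact/measurable_EFinP.
  - move=> w _ /=; rewrite normr1 lee_fin ger0_norm ?fine_ge0//.
    rewrite -lee_fin fineK// -(@prob_kernel _ _ _ _ _ K (X w)).
    by apply: le_measure; rewrite ?inE.
  - exact: finite_measure_integrable_cst.
move=> _ /sigmaXP[C mC ->].
rewrite integral_indic//; last exact: measurable_funPTI.
rewrite setIC; apply: (etrans _ (esym (XYK _ _ mC mB))).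
rewrite ge0_integral_pushforward//; last first.
  by apply: measurable_funTS; exact: measurable_kernel.
by apply: eq_integral => w _; rewrite fineK.
Qed.

End conditional_expectation.

(** * Events and variables determined by X *)

(** An idempotent version W takes only the values 0 and 1. With B = {W = 1},
    integrating W over B and over its complement gives P(A n B) = P(B) and
    P(A \ B) = 0, so A and B agree almost surely, and B lies in sigma(X). *)
Lemma cond_prob_idempotent d d' (T : measurableType d) (U : measurableType d')
    (R : realType) (P : probability T R) (X : {RV P >-> U}) (A : set T)
    (W : T -> R) :
  measurable A -> is_cond_exp X \1_A W ->
  {ae P, forall w, W w = W w * W w} ->
  exists2 C, measurable C & {ae P, forall w, A w <-> C (X w)}.
Proof.
move=> mA AW WW; have [iW mW WE] := AW.
have mWT := is_cond_exp_measurable AW.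
pose B : set T := W @^-1` [set 1].
have sB : g_sigma_algebra_preimage X B.
  by rewrite -[B]setTI; exact: mW.
have mB : measurable B := sigmaX_measurable sB.
have sCB : g_sigma_algebra_preimage X (~` B).
  exact: (@measurableC _ (g_sigma_algebra_preimageType X)).
have mCB : measurable (~` B) by exact: measurableC.
have PAB : P (B `&` A) = P B.
  rewrite setIC -[in RHS](setIid B) -!integral_indic// -WE//.
  by apply: eq_integral => w; rewrite inE indicE => Bw; rewrite mem_set// Bw.
have PACB : P (A `&` ~` B) = 0%E.
  rewrite -integral_indic// -WE//.
  transitivity (\int[P]_(w in ~` B) (cst 0%E w : \bar R))%E; last first.
    by rewrite integral_cst// mul0e.
  apply: ae_eq_integral => //.
    exact/measurable_EFinP/measurable_funTS.
  apply: filterS WW => w W2 /= W1; congr EFin.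
  apply/eqP; apply/negPn/negP => W0.
  by apply: W1; apply: (mulfI W0); rewrite mulr1 -W2.
have PBA : P (B `\` A) = 0%E.
  have -> : P (B `\` A) = (P B - P (B `&` A))%E.
    by apply: measureD => //; rewrite ltey_eq fin_num_measure.
  by rewrite PAB subee// fin_num_measure.
have [C mC BC] := (sigmaXP X B).1 sB.
exists C => //.
have := prob0_ae (measurableD mB mA) PBA.
apply: filterS2 (prob0_ae (measurableI _ _ mA mCB) PACB) => w nACB nBA.
have -> : C (X w) = B w by rewrite BC.
split => [Aw|Bw].
  by apply: contrapT => nB; apply: nACB.
by apply: contrapT => nA; apply: nBA.
Qed.

(** The function is x |-> inf {q | x in C q}, taken in the extended reals so
    that no emptiness or boundedness issue arises before an almost sure value
    is known. It is measurable because it is < r exactly on the union of the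
    C q with q < r, and at a point where all the equivalences hold it is the
    infimum of the rationals above Z. *)
Lemma fun_of_rat_events d d' (T : measurableType d) (U : measurableType d')
    (R : realType) (P : probability T R) (X : {RV P >-> U}) (Z : T -> R) :
  (forall q : rat, exists2 C, measurable C &
     {ae P, forall w, Z w < ratr q <-> C (X w)}) ->
  exists2 f : U -> R, measurable_fun [set: U] f &
    {ae P, forall w, Z w = f (X w)}.
Proof.
move=> ZC.
have /choice[C HC] : forall q : rat, exists C : set U, measurable C /\
    {ae P, forall w, Z w < ratr q <-> C (X w)}.
  by move=> q; have [C] := ZC q; exists C.
pose F x : \bar R := ereal_inf [set (ratr q)%:E | q in [set q | C q x]].
have mF : measurable_fun [set: U] F.
  move=> _; apply: (measurability _ (ErealGenInftyO.measurableE R)) => //.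
  move=> _ [_ [r ->] <-]; rewrite setTI.
  have -> : F @^-1` `]-oo, r%:E[ =
      \bigcup_(q in [set q : rat | (ratr q < r)%R]) C q.
    apply/seteqP; split => [x /=|x [q /= qr Cq]].
      rewrite in_itv/= => /ereal_inf_lt[_ [q Cq <-]].
      by rewrite lte_fin => qr; exists q.
    rewrite in_itv/=; apply: (@le_lt_trans _ _ (ratr q)%:E); last first.
      by rewrite lte_fin.
    by apply: ereal_inf_lbound; exists q.
  rewrite bigcup_mkcond; apply: bigcupT_measurable_rat => q.
  by case: ifP => // _; exact: (HC q).1.
exists (fine \o F).
  exact: (measurableT_comp (fine_measurable measurableT) mF).
have : {ae P, forall w, forall q : rat, Z w < ratr q <-> C q (X w)}.
  by apply: ae_all_count => q; exact: (HC q).2.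
apply: filterS => w Zw /=; rewrite (_ : F (X w) = (Z w)%:E)//.
apply/eqP; rewrite eq_le; apply/andP; split; last first.
  apply: le_ereal_inf_tmp => _ [q /= Cq <-].
  by rewrite lee_fin ltW//; apply/Zw.
apply/lee_addgt0Pr => e e0.
have /rat_in_itvoo[q] : Z w < Z w + e by rewrite ltrDl.
rewrite in_itv/= => /andP[/Zw Cq qe].
apply: (@le_trans _ _ (ratr q)%:E); last by rewrite -EFinD lee_fin ltW.
by apply: ereal_inf_lbound; exists q.
Qed.

(** * Orthogonality of the residual *)

Section orthogonality.
Import HBNNSimple.
Context d d' (T : measurableType d) (U : measurableType d') (R : realType).
Variables (P : probability T R) (X : {RV P >-> U}) (h : T -> R).
Hypothesis ih : P.-integrable [set: T] (EFin \o h).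
Hypothesis h0 : forall B, g_sigma_algebra_preimage X B ->
  (\int[P]_(w in B) (h w)%:E = 0)%E.

(** A sigma(X)-simple function is a finite combination of indicators of events
    over which h integrates to 0. *)
Lemma integral_nnsfun_mul_eq0
    (phi : {nnsfun g_sigma_algebra_preimageType X >-> R}) :
  (\int[P]_w (phi w * h w)%:E = 0)%E.
Proof.
have mphi r : g_sigma_algebra_preimage X (phi @^-1` [set r]).
  by have := measurable_funPTI phi (measurable_set1 r).
have phiE w : phi w * h w =
    \sum_(r <- fset_set (range phi)) r * (\1_(phi @^-1` [set r]) w * h w).
  rewrite fimfunE fsbig_finite// mulr_suml.
  by apply: eq_bigr => r _; rewrite mulrA.
under eq_integral => w _ do rewrite phiE -sumEFin.
have patch_h (B : set T) :
    (fun w => (\1_B w * h w)%:E) = (EFin \o h) \_ B.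
  by apply/funext => w; rewrite patchE indicE; case: ifP; rewrite ?mul1r ?mul0r.
have iBh r : P.-integrable [set: T]
    (fun w => (\1_(phi @^-1` [set r]) w * h w)%:E).
  have mB : measurable (phi @^-1` [set r] : set T).
    exact: sigmaX_measurable (mphi r).
  rewrite patch_h; apply: (integrable_mkcond _ mB).1.
  exact: (integrableS measurableT mB (@subsetT _ _) ih).
rewrite integral_sum//=; last first.
  by move=> r; exact: (integrableZl measurableT r (iBh r)).
apply: big1_seq => r _.
under eq_integral do rewrite EFinM.
rewrite integralZl// patch_h -integral_mkcond.
by rewrite (h0 (mphi r)) mule0.
Qed.

(** Increasing simple approximations phi n of g satisfy |phi n * h| <= |g * h|,
    so dominated convergence passes the simple case to the limit. *)
Lemma integral_ge0_mul_eq0 (g : T -> R) :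
  measurable_fun [set: g_sigma_algebra_preimageType X] g ->
  (forall w, 0 <= g w) -> P.-integrable [set: T] (EFin \o (g \* h)) ->
  (\int[P]_w (g w * h w)%:E = 0)%E.
Proof.
move=> mg g0 igh.
have mgE : measurable_fun [set: g_sigma_algebra_preimageType X] (EFin \o g).
  exact/measurable_EFinP.
pose phi := nnsfun_approx measurableT mgE.
have mphi n : measurable_fun [set: T] (phi n).
  by apply: (@sigmaX_fun_measurable _ _ _ _ _ _ X); exact: measurable_funPT.
have mh : measurable_fun [set: T] h by exact/measurable_EFinP/(measurable_int P).
have gE0 w : [set: T] w -> (0 <= (EFin \o g) w)%E by rewrite lee_fin.
have cphi w : (phi n w)%:E @[n --> \oo] --> (g w)%:E.
  exact: (cvg_nnsfun_approx measurableT mgE gE0).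
have le_phi n w : phi n w <= g w.
  by rewrite -lee_fin /phi nnsfun_approxE; exact: le_approx.
have [|||||_ _] := @dominated_convergence _ _ _ P setT measurableT
    (fun n w => (phi n w * h w)%:E) (fun w => (g w * h w)%:E)
    (fun w => `|(g w * h w)%:E|%E).
- by move=> n; apply/measurable_EFinP; exact: measurable_funM.
- by case/integrableP: igh.
- apply: aeW => w _; under eq_fun do rewrite EFinM.
  by rewrite EFinM; apply: cvgeZr.
- exact: integrable_abse igh.
- apply: aeW => w n _ /=; rewrite lee_fin !normrM ler_wpM2r// !ger0_norm//.
under eq_fun do rewrite integral_nnsfun_mul_eq0.
by move/cvg_unique; apply => //; exact: cvg_cst.
Qed.

End orthogonality.

(** * Variance *)

Section variance_facts.
Context d (T : measurableType d) (R : realType) (P : probability T R).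

Lemma variance_int (Z : T -> R) :
  ('V_P[Z] = \int[P]_w ((Z w - fine 'E_P[Z]) ^+ 2)%:E)%E.
Proof. by rewrite /variance !unlock. Qed.

Lemma variance_ae_eq (Z W : T -> R) :
  measurable_fun [set: T] Z -> measurable_fun [set: T] W ->
  {ae P, forall w, Z w = W w} -> ('V_P[Z] = 'V_P[W])%E.
Proof.
move=> mZ mW ZW.
have EZW : ('E_P[Z] = 'E_P[W])%E.
  rewrite unlock; apply: ae_eq_integral => //; try exact/measurable_EFinP.
  by apply: filterS ZW => w ->.
rewrite !variance_int EZW; apply: ae_eq_integral => //.
- by apply/measurable_EFinP/measurable_funX; exact: measurable_funB.
- by apply/measurable_EFinP/measurable_funX; exact: measurable_funB.
- by apply: filterS ZW => w ->.
Qed.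

Lemma variance_eq0 (Z : T -> R) : measurable_fun [set: T] Z ->
  ('V_P[Z] = 0)%E -> {ae P, forall w, Z w = fine 'E_P[Z]%E}.
Proof.
move=> mZ; rewrite variance_int => V0.
have mZ2 : measurable_fun setT (fun w => ((Z w - fine 'E_P[Z]%E) ^+ 2)%:E).
  by apply/measurable_EFinP/measurable_funX; exact: measurable_funB.
have := (ae_eq_integral_abs P measurableT mZ2).1.
case.
  rewrite -[RHS]V0; apply: eq_integral => w _ /=.
  by rewrite ger0_norm// sqr_ge0.
move=> N [mN PN sN]; exists N; split=> // w /= nZ; apply: sN => /= /(_ I) [].
by move/eqP; rewrite sqrf_eq0 subr_eq0 => /eqP.
Qed.

Lemma Lfun2_sqr (Z : T -> R) : measurable_fun [set: T] Z ->
  (\int[P]_w ((Z w) ^+ 2)%:E < +oo)%E -> Z \in Lfun P 2%:E.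
Proof.
move=> mZ Z2; apply/andP; split; rewrite inE//=.
rewrite /finite_norm unlock /Lnorm poweR_lty//.
under eq_integral => w _ do
  rewrite /= powR_mulrn// -normrX ger0_norm ?sqr_ge0//.
exact: Z2.
Qed.

(** A version of E(Y|X) is only known to be integrable; when its variance equals
    that of Y, finiteness of the latter makes it square-integrable. *)
Lemma Lfun2_variance_fin (Z : T -> R) : measurable_fun [set: T] Z ->
  ('V_P[Z] < +oo)%E -> Z \in Lfun P 2%:E.
Proof.
move=> mZ; rewrite variance_int => Voo.
have -> : Z = (fun w => Z w - fine 'E_P[Z]%E) \+ cst (fine 'E_P[Z]%E).
  by apply/funext => w /=; rewrite subrK.
rewrite rpredD ?lee1n// => p12; last exact: Lfun_cst.
by apply: Lfun2_sqr => //; exact: measurable_funB.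
Qed.

End variance_facts.

Section pythagoras.
Context d d' (T : measurableType d) (U : measurableType d') (R : realType).
Variables (P : probability T R) (X : {RV P >-> U}) (Y : {RV P >-> R}).
Hypothesis Y2 : (Y : T -> R) \in Lfun P 2%:E.

(** The covariance is E(W (Y - W)), since Y - W has mean 0. It vanishes because
    Y - W integrates to 0 over every event of sigma(X). That argument applies to
    nonnegative sigma(X)-measurable factors, so it is used on the positive and on the negative part of W, written max(s * W, 0) with
    s = 1 and s = -1. *)
Lemma is_cond_exp_covariance W : is_cond_exp X Y W -> W \in Lfun P 2%:E ->
  covariance P W (Y \- W) = 0%E.
Proof.
move=> [iW mW WE] W2.
have P1 : P setT \is a fin_num by exact: fin_num_measure.
have iY : P.-integrable [set: T] (EFin \o Y).
  by apply/Lfun1_integrable; exact: Lfun_subset12.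
have YW2 : Y \- W \in Lfun P 2%:E by rewrite rpredB ?lee1n.
have YW1 := Lfun_subset12 P1 YW2.
have iYW := (Lfun1_integrable P (Y \- W)).1 YW1.
have YW0 B : g_sigma_algebra_preimage X B ->
    (\int[P]_(w in B) ((Y \- W) w)%:E = 0)%E.
  move=> sB; have mB := sigmaX_measurable sB.
  have iYB : P.-integrable B (EFin \o Y) by apply: integrableS iY.
  have iWB : P.-integrable B (EFin \o W) by apply: integrableS iW.
  rewrite /= integralB_EFin//= WE// subee//.
  exact: integrable_fin_num.
have mW' : measurable_fun [set: T] W by exact: sigmaX_fun_measurable mW.
have iWYW := (Lfun1_integrable P _).1 (Lfun2_mul_Lfun1 W2 YW2).
(* the positive part of W for s = 1, the negative part for s = -1 *)
have pos (s : R) : s \in [:: 1; -1] ->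
    P.-integrable [set: T]
      (EFin \o (fun w => Num.max (s * W w) 0 * (Y \- W) w)) /\
    (\int[P]_w (Num.max (s * W w) 0 * (Y \- W) w)%:E = 0)%E.
  move=> s1; set g := EFin \o _.
  suff ig : P.-integrable [set: T] g.
    split=> //; apply: (integral_ge0_mul_eq0 iYW YW0) => //.
    - by apply: measurable_maxr => //; exact: measurable_funM.
    - by move=> w; rewrite le_max lexx orbT.
  apply: le_integrable iWYW => //.
    apply/measurable_EFinP/measurable_funM.
      by apply: measurable_maxr => //; exact: measurable_funM.
    exact/measurable_EFinP/(measurable_int P).
  move=> w _ /=; rewrite lee_fin !normrM ler_wpM2r//.
  rewrite ger0_norm ?le_max ?lexx ?orbT// ge_max normr_ge0 andbT.
  move: s1; rewrite !inE => /orP[] /eqP ->; first by rewrite mul1r ler_norm.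
  by rewrite mulN1r -normrN ler_norm.
have [//|ip ip0] := pos 1; first by rewrite inE eqxx.
have [//|im im0] := pos (-1); first by rewrite !inE eqxx orbT.
rewrite covarianceE//; last 2 first.
  exact/Lfun1_integrable.
  exact: Lfun2_mul_Lfun1.
have -> : ('E_P[(Y \- W)%R] = 0)%E.
  by rewrite unlock; apply: YW0; apply/sigmaXP; exists setT.
rewrite mule0 sube0 unlock.
transitivity (\int[P]_w (Num.max (1 * W w) 0 * (Y \- W) w -
                         Num.max (-1 * W w) 0 * (Y \- W) w)%:E)%E.
  apply: eq_integral => w _; congr EFin; rewrite -mulrBl; congr (_ * _).
  rewrite mul1r mulN1r; case: (leP 0 (W w)) => W0.
    by rewrite max_r ?oppr_le0// subr0.
  by rewrite max_l ?oppr_ge0 ?ltW// sub0r opprK.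
by rewrite integralB_EFin// ip0 im0 subee.
Qed.

(** Pythagoras: Var Y = Var W + Var (Y - W), and the residual Y - W has mean
    0. *)
Lemma cond_exp_full_variance W : is_cond_exp X Y W ->
  ('V_P[W] = 'V_P[Y])%E -> {ae P, forall w, Y w = W w}.
Proof.
move=> YW VW; have [iW mW WE] := YW.
have mWT := is_cond_exp_measurable YW.
have W2 : W \in Lfun P 2%:E.
  by apply: Lfun2_variance_fin => //; rewrite VW ltey_eq variance_fin_num.
have YW2 : Y \- W \in Lfun P 2%:E by rewrite rpredB ?lee1n.
have iY : P.-integrable [set: T] (EFin \o Y).
  by apply/Lfun1_integrable; rewrite Lfun_subset12// fin_num_measure.
have YE : (Y : T -> R) = W \+ (Y \- W).
  by apply/funext => w /=; rewrite addrC subrK.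
have V0 : ('V_P[(Y \- W)%R] = 0)%E.
  have := varianceD W2 YW2.
  rewrite -YE is_cond_exp_covariance// mule0 adde0 VW.
  rewrite -(fineK (variance_fin_num Y2)) -(fineK (variance_fin_num YW2)).
  rewrite -EFinD => -[/eqP].
  by rewrite -subr_eq0 opprD addNKr oppr_eq0 => /eqP ->.
have := variance_eq0 _ V0.
have -> : ('E_P[(Y \- W)%R] = 0)%E.
  rewrite unlock integralB_EFin//= WE ?subee//.
    by exact: integrable_fin_num.
  by apply/sigmaXP; exists setT.
move=> /(_ (measurable_funB (measurable_funPT Y) mWT)).
by apply: filterS => w /= /eqP; rewrite subr_eq0 => /eqP.
Qed.

(** A ratio equal to 1 also rules out the degenerate readings of the
    coefficient: if there were no version of E(Y|X), or if its variance were
    infinite, the numerator would be 0. *)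
Lemma full_variance_perfectly_depends : ~ degenerate Y -> R2_coef Y X = 1 ->
  perfectly_depends Y X.
Proof.
move=> Ynd; rewrite /R2_coef => R21.
have VY0 : fine ('V_P[Y])%E != 0.
  by apply: contra_eq_neq R21 => ->; rewrite invr0 mulr0 eq_sym oner_eq0.
have VE : fine ('V_P[cond_exp X Y])%E = fine ('V_P[Y])%E.
  by move/(congr1 (fun r => r * fine ('V_P[Y])%E)) : R21; rewrite divfK// mul1r.
have [[W YW]|nW] := pselect (exists W, is_cond_exp X Y W); last first.
  move: VY0; rewrite -VE /cond_exp xgetPN ?variance_cst ?eqxx//.
  by move=> W YW; apply: nW; exists W.
have Yc := cond_expP YW.
have VE' : ('V_P[cond_exp X Y] = 'V_P[Y])%E.
  rewrite -[RHS](fineK (variance_fin_num Y2)) -VE fineK// ge0_fin_numE.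
    move: VY0; rewrite -VE.
    by case: ('V_P[_])%E => //= [r _|/eqP//]; rewrite ltry.
  exact: variance_ge0.
have YcE := cond_exp_full_variance Yc VE'.
have [] := @fun_of_rat_events _ _ _ _ _ P X (cond_exp X Y).
  move=> q; have [_ mc _] := Yc.
  have /sigmaXP[C mC CE] :
      g_sigma_algebra_preimage X (cond_exp X Y @^-1` `]-oo, ratr q[).
    by rewrite -[_ @^-1` _]setTI; apply: mc.
  exists C => //; apply: aeW => w.
  have -> : C (X w) = (X @^-1` C) w by [].
  by rewrite -CE /= in_itv.
move=> f mf cf; exists f => //.
by apply: filterS2 YcE cf => w -> ->.
Qed.

End pythagoras.

(** * Non-degeneracy *)

Section bernoulli_variance.
Context d (T : measurableType d) (R : realType) (P : probability T R).

Lemma Lfun2_indic (A : set T) : measurable A ->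
  (\1_A : T -> R) \in Lfun P 2%:E.
Proof.
move=> mA; apply: Lfun2_sqr; first exact: measurable_indic.
have -> : (\int[P]_w ((\1_A w : R) ^+ 2)%:E = \int[P]_w (\1_A w)%:E)%E.
  apply: eq_integral => w _; rewrite indicE.
  by case: (w \in A); rewrite ?expr1n ?expr0n.
by rewrite integral_indic// setIT ltey_eq fin_num_measure.
Qed.

Lemma variance_indic (A : set T) : measurable A ->
  ('V_P[(\1_A : T -> R)] = (fine (P A) - fine (P A) ^+ 2)%:E)%E.
Proof.
move=> mA.
have A2 : (\1_A ^+ 2 = \1_A :> (T -> R))%R.
  apply/funext => w; rewrite exprfctE /= indicE.
  by case: (w \in A); rewrite ?expr1n ?expr0n.
rewrite varianceE ?Lfun2_indic// A2 expectation_indic//.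
by rewrite EFinB EFin_expe fineK ?fin_num_measure.
Qed.

End bernoulli_variance.

Section nondegenerate.
Context d (T : measurableType d) (R : realType) (P : probability T R).
Variable Y : {RV P >-> R}.

Lemma measurable_upper_event y : measurable [set w | y <= Y w].
Proof.
rewrite (_ : [set _ | _] = Y @^-1` `[y, +oo[); first exact: measurable_funPTI.
by apply/funext => w; rewrite /= in_itv/= andbT.
Qed.

Definition upper_tail (y : R) : R := fine (P [set w | y <= Y w]).

Local Notation G := upper_tail.

Lemma upper_tailE y : P [set w | y <= Y w] = (G y)%:E.
Proof. by rewrite fineK// fin_num_measure//; exact: measurable_upper_event. Qed.

Lemma upper_tail_ge0 y : 0 <= G y.
Proof. exact: fine_ge0. Qed.

Lemma upper_tail_le1 y : G y <= 1.
Proof.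
by rewrite -lee_fin -upper_tailE probability_le1//; exact: measurable_upper_event.
Qed.

Lemma upper_tail_noninc : {homo G : y z / y <= z >-> z <= y}.
Proof.
move=> y z yz; rewrite -lee_fin -!upper_tailE.
apply: le_measure; rewrite ?inE; [exact: measurable_upper_event..|].
by move=> w; apply: le_trans.
Qed.

Lemma measurable_upper_tail : measurable_fun [set: R] G.
Proof.
by apply: nonincreasing_measurable => // y z; exact: upper_tail_noninc.
Qed.

(** Two generic values of Y at the same level, 0 or 1, of the tail G are
    equal: a rational q strictly between them would be at that level too, hence
    almost surely Y < q (level 0) or q <= Y (level 1), against one of the two
    values. So there is at most one generic value b at level 0; as
    P(Y >= b) = G b = 0, level 0 is almost surely not attained, and Y is almost
    surely the single generic value at level 1. *)
Lemma degenerate_of_upper_tail : {ae P, forall w, G (Y w) = 0 \/ G (Y w) = 1} ->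
  degenerate Y.
Proof.
move=> G0or1.
have q0 : {ae P, forall w (q : rat), G (ratr q) = 0 -> ~ (ratr q <= Y w)}.
  apply: ae_all_count => q.
  have [Gq|] := eqVneq (G (ratr q)) 0; last by move=> /eqP nq; apply: aeW.
  have := prob0_ae (P := P) (measurable_upper_event (ratr q)).
  rewrite upper_tailE Gq => /(_ erefl).
  by apply: filterS.
have q1 : {ae P, forall w (q : rat), G (ratr q) = 1 -> ratr q <= Y w}.
  apply: ae_all_count => q.
  have [Gq|] := eqVneq (G (ratr q)) 1; last by move=> /eqP nq; apply: aeW.
  have PC : P (~` [set w | ratr q <= Y w]) = 0%E.
    by rewrite probability_setC ?upper_tailE ?Gq ?subee//;
      exact: measurable_upper_event.
  have := prob0_ae (measurableC (measurable_upper_event (ratr q))) PC.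
  by apply: filterS => w /contrapT.
pose good w := [/\ G (Y w) = 0 \/ G (Y w) = 1,
  forall q : rat, G (ratr q) = 0 -> ~ (ratr q <= Y w) &
  forall q : rat, G (ratr q) = 1 -> ratr q <= Y w].
have aegood : {ae P, forall w, good w}.
  by apply: filterS3 G0or1 q0 q1 => w.
have same_level w w' : good w -> good w' -> G (Y w) = G (Y w') -> Y w = Y w'.
  suff lt_level v v' : good v -> good v' -> G (Y v) = G (Y v') ->
      Y v < Y v' -> False.
    move=> gw gw' E; apply/eqP; case: ltgtP => // lt_.
      by case: (lt_level _ _ gw gw').
    by case: (lt_level _ _ gw' gw).
  move=> [v01 _ vq1] [_ v'q0 _] E /rat_in_itvoo[q]; rewrite in_itv/=.
  move=> /andP[vq qv'].
  have Gq : G (ratr q) = G (Y v).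
    apply/eqP; rewrite eq_le; apply/andP.
    split; first exact/upper_tail_noninc/ltW.
    by rewrite E; exact/upper_tail_noninc/ltW.
  case: v01 => Gv.
    by apply: (v'q0 q); rewrite ?Gq//; exact: ltW.
  have := vq1 q; rewrite Gq Gv => /(_ erefl).
  by rewrite leNgt vq.
have aeG1 : {ae P, forall w, good w -> G (Y w) = 1}.
  have [[w0 [gw0 G0]]|nG0] := pselect (exists w0, good w0 /\ G (Y w0) = 0).
    have := prob0_ae (P := P) (measurable_upper_event (Y w0)).
    rewrite upper_tailE G0 => /(_ erefl).
    apply: filterS => w nw gw; have [[Gw|//] _ _] := gw.
    by exfalso; apply: nw; rewrite /= (same_level w w0)// Gw.
  apply: aeW => w gw; have [[Gw|//] _ _] := gw.
  by case: nG0; exists w.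
have [[w1 [gw1 G1]]|nG1] := pselect (exists w1, good w1 /\ G (Y w1) = 1).
  exists (Y w1); apply: filterS2 aegood aeG1 => w gw /(_ gw) Gw.
  by apply: same_level; rewrite ?Gw.
exists 0; apply: filterS2 aegood aeG1 => w gw /(_ gw) Gw.
by case: nG1; exists w.
Qed.

(** Var 1_{Y >= y} = G y - (G y)^2 vanishes only where G y is 0 or 1; if the
    integral were 0, this would hold at y = Y w for almost every w. *)
Lemma indic_variance_integral_neq0 : ~ degenerate Y ->
  fine (\int[distribution P Y]_y 'V_P[(\1_[set w | (y <= Y w)%R] : T -> R)])%E != 0.
Proof.
move=> Ynd.
have VE y : ('V_P[(\1_[set w | (y <= Y w)%R] : T -> R)] =
    (G y - G y ^+ 2)%:E)%E.
  exact: (variance_indic P (measurable_upper_event y)).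
under eq_integral do rewrite VE.
have mV : measurable_fun [set: R] (fun y => (G y - G y ^+ 2)%:E).
  by apply/measurable_EFinP/measurable_funB; last apply: measurable_funX;
    exact: measurable_upper_tail.
have V0 y : 0 <= G y - G y ^+ 2.
  by rewrite subr_ge0 expr2 ler_piMl ?upper_tail_ge0 ?upper_tail_le1.
have Voo : (\int[distribution P Y]_y (G y - G y ^+ 2)%:E < +oo)%E.
  apply: (@le_lt_trans _ _ (\int[distribution P Y]_y (cst 1%:E y))%E).
    apply: ge0_le_integral => //; first by move=> y _; rewrite lee_fin.
    move=> y _ /=; rewrite lee_fin lerBlDr.
    by rewrite (le_trans (upper_tail_le1 y))// lerDl sqr_ge0.
  by rewrite integral_cst// mul1e (le_lt_trans (probability_le1 _ _))// ltry.
apply/negP => /eqP I0; apply: Ynd; apply: degenerate_of_upper_tail.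
have I0' : (\int[distribution P Y]_y (G y - G y ^+ 2)%:E = 0)%E.
  rewrite -[LHS]fineK; first by rewrite I0.
  by rewrite ge0_fin_numE// integral_ge0// => y _; rewrite lee_fin.
have [+ _] := ae_eq_integral_abs (distribution P Y) measurableT mV.
case.
  by rewrite -[RHS]I0'; apply: eq_integral => y _; rewrite gee0_abs ?lee_fin.
move=> N [mN PN sN].
exists (Y @^-1` N); split => //; first exact: measurable_funPTI.
move=> w /= nG; apply: sN => /= /(_ I) [] /eqP.
rewrite expr2 -{1}[G _]mulr1 -mulrBr mulf_eq0 subr_eq0 => /orP[] /eqP E.
  by apply: nG; left.
by apply: nG; right.
Qed.

End nondegenerate.

(** * The Markov product *)

Section conditional_copy.
Context d d' (T : measurableType d) (U : measurableType d') (R : realType).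
Variables (P : probability T R) (X : {RV P >-> U}) (Y Y' : {RV P >-> R}).

(** Both probabilities disintegrate along the law of X through kernels that
    agree almost everywhere. *)
Lemma same_cond_distribution_joint :
  same_cond_distribution X Y Y' ->
  forall (A : set U) (B : set R), measurable A -> measurable B ->
  P (X @^-1` A `&` Y' @^-1` B) = P (X @^-1` A `&` Y @^-1` B).
Proof.
move=> [K [K' [XYK XYK' KK']]] A B mA mB.
have -> := XYK A B mA mB; have -> := XYK' A B mA mB.
apply: ae_eq_integral => //.
- by apply: measurable_funTS; exact: measurable_kernel.
- by apply: measurable_funTS; exact: measurable_kernel.
- by apply: filterS KK' => x KK' _; exact: KK'.
Qed.

Lemma same_cond_distribution_law :
  same_cond_distribution X Y Y' ->
  forall B : set R, measurable B -> P (Y' @^-1` B) = P (Y @^-1` B).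
Proof.
move=> YY' B mB.
have := same_cond_distribution_joint YY' measurableT mB.
by rewrite preimage_setT !setTI.
Qed.

Lemma ae_le_of_rat_gaps (Z Z' : T -> R) :
  (forall q : rat, {ae P, forall w, ~ (Z w <= ratr q /\ ratr q < Z' w)}) ->
  {ae P, forall w, Z' w <= Z w}.
Proof.
move=> gap; apply: filterS (ae_all_count gap) => w gapw.
rewrite leNgt; apply/negP => /rat_in_itvoo[q].
by rewrite in_itv/= => /andP[/ltW Zq qZ']; exact: (gapw q).
Qed.

(** {f(X) <= q < Y'} has the probability of {f(X) <= q < Y}, which is 0 when
    Y = f(X); likewise with the inequalities reversed. *)
Lemma perfectly_depends_copy_eq : same_cond_distribution X Y Y' ->
  perfectly_depends Y X -> {ae P, forall w, Y w = Y' w}.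
Proof.
move=> YY' [f mf Yf].
have null (A B : set R) : measurable A -> measurable B ->
    A `&` B = set0 -> {ae P, forall w, ~ (A (f (X w)) /\ B (Y' w))}.
  move=> mA mB AB0.
  have mfA : measurable (f @^-1` A) by rewrite -[_ @^-1` _]setTI; exact: mf.
  have mXA : measurable (X @^-1` (f @^-1` A)) by exact: measurable_funPTI.
  have mYB (V : {RV P >-> R}) : measurable (V @^-1` B).
    exact: measurable_funPTI.
  apply: (@prob0_ae _ _ _ _ (X @^-1` (f @^-1` A) `&` Y' @^-1` B)).
    exact: measurableI.
  rewrite (same_cond_distribution_joint YY')//; apply: ae_prob0.
    exact: measurableI.
  apply: filterS Yf => w Ywf [/= Aw]; rewrite Ywf => Bw.
  by have : (A `&` B) (f (X w)) by []; rewrite AB0.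
have le1 : {ae P, forall w, Y' w <= f (X w)}.
  apply: ae_le_of_rat_gaps => q.
  have disj : `]-oo, (ratr q : R)] `&` `]ratr q, +oo[ = set0.
    apply/seteqP; split => // r [] /=; rewrite !in_itv/= andbT => rq.
    by rewrite ltNge rq.
  apply: filterS (null _ _ (measurable_itv _) (measurable_itv _) disj) => w n.
  by move=> [fq qY]; apply: n; rewrite /= !in_itv/= fq qY.
have le2 : {ae P, forall w, f (X w) <= Y' w}.
  apply: ae_le_of_rat_gaps => q.
  have disj : `]ratr q, +oo[ `&` `]-oo, (ratr q : R)] = set0.
    apply/seteqP; split => // r [] /=; rewrite !in_itv/= andbT => rq.
    by rewrite leNgt rq.
  apply: filterS (null _ _ (measurable_itv _) (measurable_itv _) disj) => w n.
  by move=> [Yq qf]; apply: n; rewrite /= !in_itv/= qf Yq.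
apply: filterS3 Yf le1 le2 => w -> l1 l2.
by apply/eqP; rewrite eq_le l1 l2.
Qed.

Lemma ae_eq_comonotone : {ae P, forall w, Y w = Y' w} -> comonotone Y Y'.
Proof.
move=> YY' y y'.
have mle (V : {RV P >-> R}) v : measurable [set w | V w <= v].
  rewrite (_ : [set _ | _] = V @^-1` `]-oo, v]); first exact: measurable_funPTI.
  by apply/funext => w; rewrite /= in_itv.
have cdfE (V : {RV P >-> R}) v : cdf V v = P [set w | V w <= v].
  by congr (P _); apply/funext => w; rewrite /= in_itv.
have cdfY' v : cdf Y' v = cdf Y v.
  rewrite !cdfE; apply: prob_ae_eq => //.
  by apply: filterS YY' => w /= ->.
rewrite cdfY'.
transitivity (cdf Y (Num.min y y')).
  rewrite cdfE; apply: prob_ae_eq => //.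
    by apply: measurableI (mle Y y) (mle Y' y').
  apply: filterS YY' => w /= <-; rewrite le_min.
  by split=> [[-> ->]//|/andP].
case: (leP y y') => yy'.
  by rewrite min_l// cdf_nondecreasing.
by rewrite min_r// cdf_nondecreasing// ltW.
Qed.

(** On the diagonal, P(Y <= q, Y' <= q) is the common value of P(Y <= q) and
    P(Y' <= q), so each of the two events is almost surely contained in the
    other. *)
Lemma comonotone_ae_eq : same_cond_distribution X Y Y' ->
  comonotone Y Y' -> {ae P, forall w, Y w = Y' w}.
Proof.
move=> YY' como.
have law := same_cond_distribution_law YY'.
pose low (V : {RV P >-> R}) q : set T := V @^-1` `]-oo, q].
have mlow V q : measurable (low V q) by exact: measurable_funPTI.
have PI q : P (low Y q `&` low Y' q) = P (low Y q).
  have := como q q.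
  rewrite (_ : [set _ | _] = low Y q `&` low Y' q); last first.
    by apply/funext => w; rewrite /low /= !in_itv.
  move=> ->; rewrite /cdf (_ : distribution P Y' _ = distribution P Y `]-oo, q]).
    by rewrite minxx.
  exact: law.
have PD A B : measurable A -> measurable B -> P (A `&` B) = P A ->
    {ae P, forall w, ~ (A w /\ ~ B w)}.
  move=> mA mB AB; apply: (@prob0_ae _ _ _ _ (A `\` B)).
    exact: measurableD.
  have -> : P (A `\` B) = (P A - P (A `&` B))%E.
    by apply: measureD => //; rewrite ltey_eq fin_num_measure.
  by rewrite AB subee// fin_num_measure.
have le1 : {ae P, forall w, Y' w <= Y w}.
  apply: ae_le_of_rat_gaps => q.
  apply: filterS (PD _ _ (mlow Y (ratr q)) (mlow Y' (ratr q)) (PI _)) => w n.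
  move=> [Yq qY']; apply: n; rewrite /low /= !in_itv/= Yq.
  by split=> //; apply/negP; rewrite -ltNge.
have le2 : {ae P, forall w, Y w <= Y' w}.
  apply: ae_le_of_rat_gaps => q.
  apply: filterS (PD _ _ (mlow Y' (ratr q)) (mlow Y (ratr q)) _) => [w n|].
    move=> [Yq qY']; apply: n; rewrite /low /= !in_itv/= Yq.
    by split=> //; apply/negP; rewrite -ltNge.
  by rewrite setIC PI; exact/esym/law.
apply: filterS2 le1 le2 => w l1 l2.
by apply/eqP; rewrite eq_le l1 l2.
Qed.

(** Since {Y in B}, {Y' in B} and {Y in B, Y' in B} agree almost surely, a
    version W of the conditional probability of the first is a version for all
    three, and conditional independence becomes W = W * W. *)
Lemma copy_eq_perfectly_depends : markov_product X Y Y' ->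
  {ae P, forall w, Y w = Y' w} -> perfectly_depends Y X.
Proof.
move=> [[K [K' [XYK _ _]]] ind] YY'.
apply: fun_of_rat_events => q.
pose B : set R := `]-oo, ratr q[%classic.
have mB : measurable B by exact: measurable_itv.
have mYB (V : {RV P >-> R}) : measurable (V @^-1` B) by exact: measurable_funPTI.
have WY := is_cond_exp_kernel XYK mB.
set W := fun w => _ in WY.
have version A : measurable A ->
    {ae P, forall w, (Y @^-1` B) w <-> A w} -> is_cond_exp X \1_A W.
  move=> mA AB; apply: (is_cond_exp_ae_eq _ _ _ WY).
  - exact: measurable_indic.
  - exact: measurable_indic.
  - apply: filterS AB => w ABw; rewrite !indicE; congr (_%:R).
    by congr nat_of_bool; apply/idP/idP; rewrite !inE => /ABw.
have WY' : is_cond_exp X \1_(Y' @^-1` B) W.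
  by apply: version => //; apply: filterS YY' => w /= ->.
have WYY' : is_cond_exp X \1_(Y @^-1` B `&` Y' @^-1` B) W.
  apply: version; first exact: measurableI.
  by apply: filterS YY' => w /= <-; split=> [|[]].
have [|C mC YC] := cond_prob_idempotent (mYB Y) WY.
  have prodW : {ae P, forall w, W w =
      cond_prob X (Y @^-1` B) w * cond_prob X (Y' @^-1` B) w}.
    by apply: filterS2 (cond_exp_ae WYY') (ind B B mB mB) => w <-.
  apply: filterS3 prodW (cond_exp_ae WY) (cond_exp_ae WY') => w + E E'.
  by rewrite /cond_prob E E'.
by exists C => //; apply: filterS YC => w <-; rewrite /B /= in_itv.
Qed.

End conditional_copy.

Section full_coefficients.
Context d d' (T : measurableType d) (U : measurableType d') (R : realType).
Variables (P : probability T R) (X : {RV P >-> U}) (Y : {RV P >-> R}).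
Hypothesis Ynd : ~ degenerate Y.

(** For every y the event {Y >= y} is, almost surely, the event
    {f(X) >= y} of sigma(X), so its conditional probability is its
    indicator. *)
Lemma perfectly_depends_xi1 : perfectly_depends Y X -> xi_coef Y X = 1.
Proof.
move=> [f mf Yf]; rewrite /xi_coef.
have E y : ('V_P[cond_prob X [set w | (y <= Y w)%R]] =
    'V_P[(\1_[set w | (y <= Y w)%R] : T -> R)])%E.
  set A := [set w | _].
  have mA : measurable A by exact: measurable_upper_event.
  have mE : measurable_fun setT (\1_(`[y, +oo[ : set R) \o f : U -> R).
    by apply: measurableT_comp => //; exact: measurable_indic.
  have [|| mc cE] := cond_exp_fun (X := X) (Z := \1_A) mE.
  - apply/Lfun1_integrable/Lfun_subset12; first exact: fin_num_measure.
    exact: Lfun2_indic.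
  - apply: filterS Yf => w Ywf.
    rewrite /= !indicE; congr (_%:R); congr nat_of_bool.
    by apply/idP/idP; rewrite !inE /A /= in_itv/= andbT -Ywf.
  - by apply: variance_ae_eq => //; exact: measurable_indic.
under eq_integral do rewrite E.
by rewrite divff//; exact: indic_variance_integral_neq0.
Qed.

Lemma perfectly_depends_R21 : (Y : T -> R) \in Lfun P 2%:E ->
  perfectly_depends Y X -> R2_coef Y X = 1.
Proof.
move=> Y2 [f mf Yf]; rewrite /R2_coef.
have iY : P.-integrable [set: T] (EFin \o Y).
  by apply/Lfun1_integrable; rewrite Lfun_subset12// fin_num_measure.
have [mc cE] := cond_exp_fun mf iY Yf.
rewrite (variance_ae_eq mc _ cE)//.
rewrite divff//; apply/eqP => V0; apply: Ynd; exists (fine 'E_P[Y]%E).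
apply: variance_eq0; first exact: measurable_funPT.
by rewrite -(fineK (variance_fin_num Y2)) V0.
Qed.

End full_coefficients.

Theorem theorem3p1 (R : realType) (d : measure_display)
    (T : measurableType d) (P : probability T R) (p : nat)
    (X : {RV P >-> p.-tuple R}) (Y Y' : {RV P >-> R})
    (Y_L2 : (Y : T -> R) \in Lfun P 2%:E)
    (Y_nondegenerate : ~ degenerate Y)
    (YY'_markov : markov_product X Y Y') :
  [<-> xi_coef Y X = 1 /\ R2_coef Y X = 1;
       perfectly_depends Y X;
       comonotone Y Y';
       {ae P, forall w : T, Y w = Y' w}].
Proof.
have copy := YY'_markov.1.
tfae.
- by move=> [_]; exact: full_variance_perfectly_depends.
- by move=> /(perfectly_depends_copy_eq copy); exact: ae_eq_comonotone.
- exact: comonotone_ae_eq copy.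
- move=> /(copy_eq_perfectly_depends YY'_markov) YX; split.
    exact: perfectly_depends_xi1.
  exact: perfectly_depends_R21.
Qed.
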